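(* Let $(X,S)$ be an association scheme and let $F$ be a field. Then for every $A\in FS$ and every $\lambda\in F$, the relation $e_\lambda(A)=\{(x,y)\in X\times X:\ \lambda Ax=Ay\}$ belongs to $S^*$.
   Context: An association scheme $(X,S)$ consists of a finite set $X$ and a partition $S$ of $X\times X$ closed under transposition, containing the diagonal $\Delta$, such that for $r,s,t\in S$ the number $|\{z:(x,z)\in r,(z,y)\in s\}|$ is independent of $(x,y)\in t$. $S^*$ denotes the set of all unions of subsets of $S$ (including the empty union). For a field $F$, the adjacency algebra $FS\subseteq\mathrm{Mat}_X(F)$ is the $F$-span of the $\{0,1\}$ adjacency matrices $A_s$, $s\in S$. For $A\in \mathrm{Mat}_X(F)$ and $x\in X$, $Ax$ denotes the $x$-th column of $A$, viewed as a vector in $F^X$. *)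

(* Defs.v *)
From HB Require Import structures.
From mathcomp Require Import all_boot all_order all_algebra.

Set Implicit Arguments.
Unset Strict Implicit.
Unset Printing Implicit Defensive.

Import GRing.Theory.
Local Open Scope ring_scope.

Definition diag_rel (X : finType) : {set X * X} := [set p | p.1 == p.2].

Definition transpose_rel (X : finType) (s : {set X * X}) : {set X * X} :=
  [set p | (p.2, p.1) \in s].

(* [partition] requires nonempty blocks, so [diag_in_scheme] forces X to be
   nonempty. *)
Record association_scheme (X : finType) (S : {set {set X * X}}) : Prop :=
  AssociationScheme {
    scheme_partition : partition S [set: X * X];
    scheme_transpose : forall s, s \in S -> transpose_rel s \in S;
    diag_in_scheme : diag_rel X \in S;
    scheme_regular : forall r s t, r \in S -> s \in S -> t \in S ->
      forall x y x' y' : X, (x, y) \in t -> (x', y') \in t ->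
      #|[set z | ((x, z) \in r) && ((z, y) \in s)]|
      = #|[set z | ((x', z) \in r) && ((z, y') \in s)]| }.

Definition scheme_relations (X : finType) (S : {set {set X * X}}) :
    {set {set X * X}} :=
  [set cover P | P in powerset S].

(* Matrices with rows and columns indexed by X are square matrices of size
   #|X|, elements of X being identified with their rank in [enum X]. *)
Definition adjacency_mx (F : fieldType) (X : finType) (s : {set X * X}) :
    'M[F]_#|X| :=
  \matrix_(i, j) ((enum_val i, enum_val j) \in s)%:R.

Definition adjacency_algebra (F : fieldType) (X : finType)
    (S : {set {set X * X}}) : {vspace 'M[F]_#|X|} :=
  <<[seq adjacency_mx F s | s <- enum S]>>%VS.

Definition column_at (F : fieldType) (X : finType) (A : 'M[F]_#|X|) (x : X) :
    'cV[F]_#|X| :=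
  col (enum_rank x) A.

Definition column_rel (F : fieldType) (X : finType) (lambda : F)
    (A : 'M[F]_#|X|) : {set X * X} :=
  [set p | lambda *: column_at A p.1 == column_at A p.2].

(* Main.v *)
(** Membership of (x, y) in the relation says that lambda A(z, x) = A(z, y) for
    all z.  Since A is constant on each relation of the scheme, this depends only
    on which pairs of relations (r, s) admit a z with (z, x) in r and (z, y) in
    s, i.e. on which intersection numbers are nonzero, hence only on the relation
    containing (x, y); this works in every characteristic. *)
Require Import Defs.
From mathcomp Require Import all_boot all_order all_algebra.

Set Implicit Arguments.
Unset Strict Implicit.
Unset Printing Implicit Defensive.

Import GRing.Theory.
Local Open Scope ring_scope.

Lemma scheme_relationP (X : finType) (S : {set {set X * X}})
    (hS : association_scheme S) (x y : X) : exists2 s, s \in S & (x, y) \in s.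
Proof.
have := scheme_partition hS; case/and3P=> /eqP covS _ _.
have : (x, y) \in cover S by rewrite covS inE.
by case/bigcupP=> s; exists s.
Qed.

Lemma scheme_relation_uniq (X : finType) (S : {set {set X * X}})
    (hS : association_scheme S) (r s : {set X * X}) (p : X * X) :
  r \in S -> s \in S -> p \in r -> p \in s -> r = s.
Proof.
case/and3P: (scheme_partition hS) => _ tiS _ rS sS pr ps.
by rewrite -(def_pblock tiS rS pr) (def_pblock tiS sS ps).
Qed.

(** By linearity only the generators matter, and the matrix of [r] has constant entry on [s]: 1 if
    [r = s], and 0 otherwise because distinct blocks are disjoint. *)
Lemma adjacency_algebra_const (X : finType) (S : {set {set X * X}})
    (F : fieldType) (hS : association_scheme S) (A : 'M[F]_#|X|)
    (hA : A \in adjacency_algebra F S) (s : {set X * X}) (x y x' y' : X) :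
  s \in S -> (x, y) \in s -> (x', y') \in s ->
  A (enum_rank x) (enum_rank y) = A (enum_rank x') (enum_rank y').
Proof.
move=> sS xy xy'; rewrite (coord_span (X := in_tuple _) hA) !summxE.
apply: eq_bigr => i _; rewrite !mxE; congr (_ * _).
have /mapP[r rS ->] := mem_nth 0 (ltn_ord i).
rewrite mem_enum in rS; rewrite !mxE !enum_rankK; congr (_ %:R); congr nat_of_bool.
by apply/idP/idP => h; [rewrite (scheme_relation_uniq hS rS sS h xy)
  | rewrite (scheme_relation_uniq hS rS sS h xy')].
Qed.

(** The point [z'] makes an intersection number at [t] positive, and regularity carries positivity
    over to [(x, y)]. Regularity counts [z] through pairs [(x, z)], while columns call for [(z, x)];
    hence the transpose of [r]. *)
Lemma scheme_third_point (X : finType) (S : {set {set X * X}})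
    (hS : association_scheme S) (r s t : {set X * X}) (x y x' y' z' : X) :
  r \in S -> s \in S -> t \in S -> (x, y) \in t -> (x', y') \in t ->
  (z', x') \in r -> (z', y') \in s ->
  exists2 z, (z, x) \in r & (z, y) \in s.
Proof.
move=> rS sS tS xy xy' zx' zy'.
have := scheme_regular hS (scheme_transpose hS rS) sS tS xy xy'.
set n' := #|[set z | ((x', z) \in _) && _]| => eq_n.
have : (0 < n')%N by apply/card_gt0P; exists z'; rewrite !inE zx' zy'.
by rewrite -eq_n => /card_gt0P[z]; rewrite !inE /= => /andP[]; exists z.
Qed.

Lemma column_relP (X : finType) (F : fieldType) (lambda : F) (A : 'M[F]_#|X|)
    (x y : X) :
  reflect (forall z, lambda * A (enum_rank z) (enum_rank x)
                     = A (enum_rank z) (enum_rank y))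
          ((x, y) \in column_rel lambda A).
Proof.
rewrite inE /= /column_at; apply: (iffP eqP) => [/matrixP e z | e].
  by have := e (enum_rank z) 0; rewrite !mxE.
(* Every row index is the rank of a point, so the hypothesis on points reaches all rows. *)
by apply/matrixP=> i j; rewrite !mxE -(enum_valK i) e.
Qed.

(** One implication suffices, as the two pairs of [t] are interchangeable. *)
Lemma column_rel_invariant (X : finType) (S : {set {set X * X}})
    (F : fieldType) (hS : association_scheme S) (A : 'M[F]_#|X|) (lambda : F)
    (hA : A \in adjacency_algebra F S) (t : {set X * X}) (x y x' y' : X) :
  t \in S -> (x, y) \in t -> (x', y') \in t ->
  (x, y) \in column_rel lambda A -> (x', y') \in column_rel lambda A.
Proof.
move=> tS xy xy' /column_relP e; apply/column_relP=> z'.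
have [r rS zx'] := scheme_relationP hS z' x'.
have [s sS zy'] := scheme_relationP hS z' y'.
have [z zx zy] := scheme_third_point hS rS sS tS xy xy' zx' zy'.
rewrite (adjacency_algebra_const hS hA rS zx' zx) e.
exact: (adjacency_algebra_const hS hA sS zy zy').
Qed.

Theorem theorem2p1 (X : finType) (S : {set {set X * X}}) (F : fieldType)
    (hS : association_scheme S) (A : 'M[F]_#|X|) (lambda : F)
    (hA : A \in adjacency_algebra F S) :
  column_rel lambda A \in scheme_relations S.
Proof.
(* The witness collects the blocks lying inside the relation; by invariance, any block that meets
   the relation is among them. *)
apply/imsetP; exists [set t in S | t \subset column_rel lambda A].
  by rewrite powersetE; apply/subsetP=> t; rewrite inE => /andP[].
apply/setP=> -[x y]; apply/idP/bigcupP => [e | [t]]; last first.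
  by rewrite inE => /andP[_ /subsetP]; apply.
have [t tS xy] := scheme_relationP hS x y; exists t => //.
rewrite inE tS; apply/subsetP=> -[x' y'] xy'.
exact: (column_rel_invariant hS hA tS xy xy' e).
Qed.
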